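(* Let $\epsilon\in(0,1)$ and consider the discrete-time single-server queue with mean arrival $\lambda_\epsilon$, mean potential service $\mu_\epsilon$, variances $\sigma_{\epsilon,a}^2,\sigma_{\epsilon,s}^2$, and arrivals and potential services bounded by $A$, where $\lambda_\epsilon=\mu_\epsilon(1-\epsilon)$. Let $\sigma_\epsilon^2:=\sigma_{\epsilon,a}^2+\sigma_{\epsilon,s}^2$, $$\theta_\epsilon:=\frac{2\mu_\epsilon}{\sigma_\epsilon^2},\qquad \kappa_1:=\frac{2\mu_\epsilon E_3}{3\sigma_\epsilon^4}+\epsilon\,\frac{9\mu_\epsilon^2A^4}{\sigma_\epsilon^6},\qquad E_3:=\max\{0,\mathbb E[(a-s)^3]\}.$$ Suppose $\mathbb E[e^{\epsilon\theta q(0)}]<\infty$ for all $\theta\le\theta_\epsilon$. Then, for all $x>\frac{1+\kappa_1\epsilon}{\theta_\epsilon}$, the steady-state queue length $q$ satisfies $$\mathbb P(\epsilon q>x)\le e\,\theta_\epsilon x\,e^{-\theta_\epsilon(1-\kappa_1\epsilon)x}.$$ Further, $$\lim_{x\to\infty}\frac1x\log\mathbb P(\epsilon q>x)\le-\theta_\epsilon(1-\kappa_1\epsilon).$$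
   Context: Discrete-time single-server queue: $q(t)$ is the number of customers at the beginning of slot $t=0,1,2,\dots$. Arrivals $\{a(t)\}$ are i.i.d., nonnegative integer valued, with $\mathbb E[a(t)]=\lambda_\epsilon$, $\mathrm{Var}(a(t))=\sigma_{\epsilon,a}^2$, $a(t)\le A$ a.s. Potential services $\{s(t)\}$ are i.i.d., nonnegative integer valued, with $\mathbb E[s(t)]=\mu_\epsilon$, $\mathrm{Var}(s(t))=\sigma_{\epsilon,s}^2$, $s(t)\le A$ a.s. The two sequences are independent of each other and of $q(0)$ (so $a(t),s(t)$ are independent of $q(t)$). It is assumed that $\sigma_\epsilon^2>0$. The queue evolves by $q(t+1)=[q(t)+a(t)-s(t)]^+$, $[y]^+=\max\{y,0\}$. Since $\lambda_\epsilon<\mu_\epsilon$ the chain is positive recurrent; $\pi_\epsilon$ is its stationary distribution and $q\sim\pi_\epsilon$. $a$ and $s$ denote generic variables with the laws of $a(t)$, $s(t)$. Convention: $\log 0=-\infty$. *)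

(* Defs.v *)
From HB Require Import structures.
From mathcomp Require Import all_boot all_order all_algebra finmap.
From mathcomp Require Import all_classical all_reals all_analysis.

Set Implicit Arguments.
Unset Strict Implicit.
Unset Printing Implicit Defensive.

Import Order.TTheory GRing.Theory Num.Theory.
Import numFieldNormedType.Exports.

Local Open Scope classical_set_scope.
Local Open Scope ring_scope.

(* Independence of an arbitrary family: the product rule over every finite
   subfamily. *)
Definition mutually_independent {d d' : measure_display}
    {T : measurableType d} {T' : measurableType d'} {R : realType}
    (P : probability T R) {I : choiceType} (X : I -> {RV P >-> T'}) : Prop :=
  forall (J : {fset I}) (B : I -> set T'),
    (forall i : I, i \in J -> measurable (B i)) ->
    P (\bigcap_(i in [set` J]) (X i @^-1` B i)) =
      (\prod_(i <- J) P (X i @^-1` B i))%E.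
Arguments mutually_independent {d d' T T' R} P {I} X.

Definition identically_distributed {d d' : measure_display}
    {T : measurableType d} {T' : measurableType d'} {R : realType}
    (P : probability T R) (X : nat -> {RV P >-> T'}) : Prop :=
  forall (t : nat) (B : set T'), measurable B ->
    distribution P (X t) B = distribution P (X 0%N) B.
Arguments identically_distributed {d d' T T' R} P X.

(* The family (q(0), a(0), s(0), a(1), s(1), ...).  Its mutual independence
   says at once that the a(t) are independent, that the s(t) are independent,
   and that the two sequences and q(0) are independent of each other. *)
Definition queue_inputs {d : measure_display} {T : measurableType d}
    {R : realType} (P : probability T R) (q0 : {RV P >-> nat})
    (a s : nat -> {RV P >-> nat}) (i : option (nat + nat)) : {RV P >-> nat} :=
  match i with
  | None => q0
  | Some (inl t) => a t
  | Some (inr t) => s t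
  end.
Arguments queue_inputs {d T R} P q0 a s i.

(* Subtraction on nat is truncated, so this is [q + a - s]^+. *)
Definition queue_step (q a s : nat) : nat := (q + a - s)%N.

(* nu is invariant under the transition kernel
   n |-> law of [n + a - s]^+ of the queue-length chain. *)
Definition queue_stationary {d : measure_display} {T : measurableType d}
    {R : realType} (P : probability T R) (a s : {RV P >-> nat})
    (nu : probability nat R) : Prop :=
  forall B : set nat, measurable B ->
    nu B = (\int[nu]_n P [set w | B (queue_step n (a w) (s w))])%E.
Arguments queue_stationary {d T R} P a s nu.

Definition third_moment_pos {d : measure_display} {T : measurableType d}
    {R : realType} (P : probability T R) (a s : {RV P >-> nat}) : R :=
  Num.max 0 (fine 'E_P[fun w => (((a w)%:R - (s w)%:R) ^+ 3)%R]%E).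
Arguments third_moment_pos {d T R} P a s.

Definition theta_of {R : realType} (mu sigma2 : R) : R := 2 * mu / sigma2.

(* sigma2 stands for sigma^2: sigma^4 and sigma^6 are its square and cube. *)
Definition kappa1_of {R : realType} (eps mu sigma2 A E3 : R) : R :=
  2 * mu * E3 / (3 * sigma2 ^+ 2) + eps * (9 * mu ^+ 2 * A ^+ 4 / sigma2 ^+ 3).

(* Main.v *)
(* Write u n = P(q >= n) and X = a - s.  Stationarity says that u is harmonic
   for the walk: u n = E[u (n - X)] for n > 0, with u = 1 on the nonpositive
   integers and u -> 0 at infinity.  As P(X < 0) > 0, a minimum principle
   holds for superharmonic functions; applied to exp(- eta n) - u n it gives
   u n <= exp(- eta n) as soon as E[exp(eta X)] <= 1, and applied to
   u (m + n) - u m * u n it gives supermultiplicativity, hence the existence of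
   the logarithmic limit by Fekete's argument.  A fourth order Taylor bound
   shows that eta = eps theta_eps (1 - kappa1 eps) satisfies
   E[exp(eta X)] <= 1 when kappa1 eps <= 1; otherwise the bound is trivial. *)

Require Import Defs.
From mathcomp Require Import all_boot all_order all_algebra finmap.
From mathcomp Require Import all_classical all_reals all_analysis.
From mathcomp Require Import measurable_realfun zify ring lra.

Import Order.TTheory GRing.Theory Num.Theory.
Import numFieldNormedType.Exports.

Set Implicit Arguments.
Unset Strict Implicit.
Unset Printing Implicit Defensive.

Local Open Scope classical_set_scope.
Local Open Scope ring_scope.

(** * Minimum principle for the reflected walk, and its two consequences *)

Section ReflectedWalk.
Variables (R : realType) (I : finType) (p : I -> R) (up down : I -> nat).
Hypothesis p_ge0 : forall i, 0 <= p i.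
Hypothesis p_sum1 : \sum_i p i = 1.
Hypothesis has_down : exists i, 0 < p i /\ (up i < down i)%N.

(** A negative value would make [f] attain a negative global minimum, at finitely many points only.
    Averaging at such a point forces every point reached with positive probability to be a minimiser
    too. *)
Lemma superharmonic_ge0 (f : nat -> R) : 0 <= f 0%N ->
  (forall n, (0 < n)%N -> \sum_i p i * f (n + down i - up i)%N <= f n) ->
  (forall e, 0 < e -> exists N, forall n, (N <= n)%N -> - e <= f n) ->
  forall n, 0 <= f n.
Proof.
move=> f0 fharm flim n0; rewrite leNgt; apply/negP => fn0.
(* Beyond [N] the values stay above [f n0 / 2], hence above [f n0]: the minimum may be sought below
   [N]. *)
have [N HN] := flim (- f n0 / 2) ltac:(lra).
have n0N : (n0 < N)%N by rewrite ltnNge; apply/negP => /HN; lra.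
have [m _ mmin] := @arg_minP _ _ _ (Ordinal n0N) xpredT (fun k : 'I_N => f k) isT.
have fm k : f m <= f k.
  have [kN|kN] := ltnP k N; first exact: (mmin (Ordinal kN)).
  have := HN _ kN; have := mmin (Ordinal n0N) isT => /=; lra.
have fm0 : f m < 0 by apply: le_lt_trans fn0; exact: fm.
have mbd k : f k == f m -> (k <= N)%N.
  move=> /eqP fk; rewrite leqNgt; apply/negP => /ltnW /HN.
  have := fm n0; lra.
have ex : exists k, f k == f m by exists m.
(* the largest global minimiser: a downward service pushes it further out *)
case: (ex_maxnP ex mbd) => M /eqP fM Mmax.
have M0 : (0 < M)%N by case: M fM {Mmax} => [fM|//]; lra.
have [i [pi ud]] := has_down.
have step_ge j : 0 <= p j * (f (M + down j - up j)%N - f m).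
  by apply: mulr_ge0 => //; rewrite subr_ge0.
have le0 : \sum_j p j * (f (M + down j - up j)%N - f m) <= 0.
  under eq_bigr do rewrite mulrBr.
  rewrite sumrB -mulr_suml p_sum1 mul1r -fM.
  by have := fharm _ M0; lra.
have : p i * (f (M + down i - up i)%N - f m) <= 0.
  apply: le_trans le0; rewrite (bigD1 i)//= lerDl.
  by apply: sumr_ge0.
rewrite pmulr_rle0// subr_le0 => fi.
have /Mmax : f (M + down i - up i)%N == f m by rewrite eq_le fi fm.
lia.
Qed.

Variable u : nat -> R.
Hypothesis u_ge0 : forall n, 0 <= u n.
Hypothesis u0 : u 0%N = 1.
Hypothesis u_nincr : forall m n, (m <= n)%N -> u n <= u m.
Hypothesis u_cvg0 : forall e : R, 0 < e -> exists N, forall n, (N <= n)%N -> u n <= e.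
(* Truncated subtraction encodes the boundary value 1 on negative integers. *)
Hypothesis u_harm : forall n, (0 < n)%N ->
  u n = \sum_i p i * u (n + down i - up i)%N.

(** The bound on the exponential moment makes [expR (- (eta * n))] superharmonic, while [u] is
    harmonic; their difference vanishes at 0 and is at least [- u n], which tends to 0. *)
Lemma lundberg (eta : R) : 0 <= eta ->
  \sum_i p i * expR (eta * ((up i)%:R - (down i)%:R)) <= 1 ->
  forall n, u n <= expR (- (eta * n%:R)).
Proof.
move=> eta0 mgf n; rewrite -subr_ge0.
apply: (@superharmonic_ge0 (fun n => expR (- (eta * n%:R)) - u n)) => //=.
- by rewrite mulr0 oppr0 expR0 u0 subrr.
- move=> {}n n0; under eq_bigr do rewrite mulrBr.
  rewrite sumrB -u_harm// lerB//.
  apply: (@le_trans _ _ (expR (- (eta * n%:R)) *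
      \sum_i p i * expR (eta * ((up i)%:R - (down i)%:R)))); last first.
    by rewrite ler_piMr// expR_ge0.
  rewrite mulr_sumr; apply: ler_sum => i _.
  rewrite mulrCA ler_wpM2l// -expRD ler_expR.
  (* Truncation can only raise the position, which lowers the exponential. *)
  have : n%:R + (down i)%:R - (up i)%:R <= (n + down i - up i)%:R :> R.
    by rewrite lerBlDr -!natrD ler_nat; lia.
  nra.
- move=> e e0; have [N HN] := u_cvg0 e0; exists N => m Nm.
  by have := HN _ Nm; have := expR_ge0 (- (eta * m%:R)); lra.
Qed.

Lemma tail_supermultiplicative m n : u m * u n <= u (m + n)%N.
Proof.
rewrite -subr_ge0.
apply: (@superharmonic_ge0 (fun n => u (m + n)%N - u m * u n)) => //=.
- by rewrite addn0 u0 mulr1 subrr.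
- move=> {}n n0; under eq_bigr do rewrite mulrBr mulrCA.
  rewrite sumrB -mulr_sumr -u_harm// lerB//.
  rewrite [leRHS]u_harm ?addn_gt0 ?n0 ?orbT//.
  (* Truncating before adding [m] leaves a position at least as large as truncating after, and [u]
     is nonincreasing. *)
  by apply: ler_sum => i _; rewrite ler_wpM2l// u_nincr//; lia.
- move=> e e0; have [N HN] := u_cvg0 e0; exists N => k Nk.
  have := HN _ Nk; have := u_ge0 (m + k); have := u_ge0 k.
  have : u m <= 1 by rewrite -u0 u_nincr.
  have := u_ge0 m; nra.
Qed.

End ReflectedWalk.

(** * Fekete's lemma on the half-line *)

Section Fekete.
Variable R : realType.

(** The limit is the infimum of [y^-1 * w y] over [y > 0]. Monotonicity of [w] handles the remainder
    of the division of [x] by [y]. *)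
Lemma is_cvg_div_subadditive (w : R -> R) :
  (forall x, 0 <= x -> 0 <= w x) ->
  (forall x y, 0 <= x -> x <= y -> w x <= w y) ->
  (forall x y, 0 <= x -> 0 <= y -> w (x + y) <= w x + w y) ->
  cvg ((x^-1 * w x) @[x --> +oo%R]).
Proof.
move=> w0 w_nd w_sub.
have w_mul n y : 0 <= y -> w (n.+1%:R * y) <= n.+1%:R * w y.
  move=> y0; elim: n => [|n ih]; first by rewrite !mul1r.
  rewrite -[n.+2%:R]natr1 mulrDl mul1r.
  apply: le_trans (w_sub _ _ _ y0) _; first by rewrite mulr_ge0.
  by rewrite (mulrDl _ _ (w y)) mul1r lerD2r.
(* Cover [[0, x]] by [truncn (x / y) + 1] intervals of length [y]; the extra one costs [x^-1 * w y],
   which vanishes for fixed [y]. *)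
have w_le x y : 0 < x -> 0 < y -> x^-1 * w x <= y^-1 * w y + x^-1 * w y.
  move=> x0 y0; rewrite -mulrDl -ler_pdivlMl ?invr_gt0// invrK mulrA.
  rewrite mulrDr divff ?gt_eqF//.
  have xy0 : 0 <= x / y by rewrite divr_ge0 ?ltW.
  have /andP[t1 t2] := truncn_itv xy0.
  apply: (@le_trans _ _ (w ((Num.truncn (x / y)).+1%:R * y))).
    by apply: w_nd; [exact: ltW|rewrite -ler_pdivrMr// ltW].
  apply: le_trans (w_mul _ _ (ltW y0)) _.
  by apply: ler_wpM2r; [exact/w0/ltW|rewrite -natr1 lerD2r].
pose S := [set y^-1 * w y | y in [set y : R | 0 < y]].
have S0 : S !=set0 by exists (1^-1 * w 1); exists 1 => //=; exact: ltr01.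
have Slb : has_lbound S.
  by exists 0 => _ [y y0 <-]; rewrite mulr_ge0 ?invr_ge0 ?w0 // ltW.
apply/cvg_ex; exists (inf S); apply/cvgrPdist_le => e e0.
have [_ [y y0 <-] ye] := @inf_adherent _ S (e / 2) ltac:(lra) (conj S0 Slb).
near=> x.
have x0 : 0 < x by near: x; exact: nbhs_pinfty_gt.
have infx : inf S <= x^-1 * w x by apply: ge_inf => //; exists x.
have : x^-1 * w y <= e / 2.
  rewrite ler_pdivrMl// -ler_pdivrMr; last lra.
  by near: x; apply: nbhs_pinfty_ge; exact: num_real.
have := w_le _ _ x0 y0.
rewrite ler_norml; lra.
Unshelve. all: by end_near. Qed.

End Fekete.

(** * Taylor bound and the exponential moment of one increment *)

Section Exp.
Variable R : realType.

(** The polynomial times [expR (- y)] has derivative [y ^+ 3 * (1 / 2 - y / 6) * expR (- y)],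
    negative below 0 and nonnegative on [[0, 3]], so its minimum there is its value 1 at 0. The
    fourth-order coefficient 1/6 is what produces this factorisation. *)
Lemma expR_le_taylor3 (y : R) : y <= 3 ->
  expR y <= 1 + y + y ^+ 2 / 2 + y ^+ 3 / 6 + y ^+ 4 / 6.
Proof.
move=> y3.
pose pol (y : R) := 1 + y + y ^+ 2 / 2 + y ^+ 3 / 6 + y ^+ 4 / 6.
pose g (y : R) := pol y * expR (- y).
suff : 1 <= g y.
  by rewrite /g expRN -ler_pdivrMr ?invr_gt0 ?expR_gt0// invrK mul1r.
pose g' (y : R) := y ^+ 3 * (1 / 2 - y / 6) * expR (- y).
have dg (x : R) : is_derive x (1 : R) g (g' x).
  rewrite /g /pol; apply: is_derive_eq.
  by rewrite /g' /GRing.scale/= !mulr0; move: (expR _) => E; field.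
have cg (x : R) : {for x, continuous g}.
  by apply: differentiable_continuous; apply/derivable1_diffP; case: (dg x).
have g0 : g 0 = 1 by rewrite /g /pol oppr0 expR0 !expr0n/=; lra.
have d1 x : derive1 g x = g' x by rewrite derive1E; case: (dg x).
have [y0|y0] := leP 0 y.
  rewrite -g0; apply: (@ger0_derive1_ndecr _ g 0 3) => //.
  + move=> x; rewrite in_itv/= => /andP[x0 x3]; rewrite d1.
    by rewrite !mulr_ge0 ?expR_ge0 ?exprn_ge0 //; lra.
  + by apply: continuous_subspaceT => x; exact: cg.
rewrite -g0; apply: (@ler0_derive1_nincrNy _ g 0) => //; last exact: ltW.
+ move=> x; rewrite in_itv/= => x0; rewrite d1.
  have x30 : x ^+ 3 <= 0 by rewrite exprS mulr_le0_ge0 ?sqr_ge0 ?ltW.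
  apply: mulr_le0_ge0; last exact: expR_ge0.
  by apply: mulr_le0_ge0 => //; lra.
+ by apply: continuous_subspaceT => x; exact: cg.
Qed.

End Exp.

(** With [eta = 2 * r * (1 - k * eps)], the drift and variance terms of the expansion leave
    [- eta * r * s * (k * eps)]. The constant [k] is chosen so that this gain pays for the third and
    fourth order terms. *)
Lemma mgf_le1 (R : realType) (I : finType) (p Y : I -> R) (eps mu s A E3 : R) :
  (forall i, 0 <= p i) -> \sum_i p i = 1 -> (forall i, `|Y i| <= A) ->
  0 < eps -> 0 <= mu -> 0 < s -> 0 <= E3 ->
  \sum_i p i * Y i = - (mu * eps) ->
  \sum_i p i * Y i ^+ 2 = s + (mu * eps) ^+ 2 ->
  \sum_i p i * Y i ^+ 3 <= E3 ->
  let k := kappa1_of eps mu s A E3 in k * eps <= 1 ->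
  \sum_i p i * expR (eps * (theta_of mu s * (1 - k * eps)) * Y i) <= 1.
Proof.
move=> p0 p1 YA eps0 mu0 s0 E30 m1 m2 m3 k k1.
pose r := eps * mu / s; pose delta := 1 - k * eps; pose eta := 2 * r * delta.
have r0 : 0 <= r by rewrite /r divr_ge0 ?mulr_ge0// ltW.
have muE : mu * eps = r * s by rewrite /r; field; lra.
(* From here on [k], [eps] and [mu] enter only through [r]: the first summand will offset the third
   moment, the second the fourth order terms. *)
have sk : s * (k * eps) = 2 / 3 * r * E3 + 9 * r ^+ 2 * A ^+ 4.
  by rewrite /k /kappa1_of /r; field; lra.
have etaE : eps * (theta_of mu s * (1 - k * eps)) = eta.
  by rewrite /eta /theta_of -/delta /r; field; lra.
rewrite etaE; clear etaE; clearbody r.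
have [i0 _] : exists i : I, true.
  have [i|nI] := pickP (fun i : I => true); first by exists i.
  by move: p1; rewrite big_pred0// => /eqP; rewrite eq_sym oner_eq0.
have A0 : 0 <= A by apply: le_trans (YA i0).
have A40 : 0 <= A ^+ 4 by rewrite (exprM A 2 2) sqr_ge0.
have k0 : 0 <= k * eps.
  rewrite -(pmulr_rge0 _ s0) sk; apply: addr_ge0;
    by rewrite ?mulr_ge0 ?sqr_ge0 ?invr_ge0.
have d0 : 0 <= delta by rewrite /delta; lra.
have d1 : delta <= 1 by rewrite /delta; lra.
have eta0 : 0 <= eta by rewrite /eta !mulr_ge0.
have eta_le : eta <= 2 * r by rewrite /eta ler_piMr// mulr_ge0.
have Y2A i : Y i ^+ 2 <= A ^+ 2.
  by rewrite -real_normK ?num_real// lerXn2r ?nnegrE// (le_trans _ (YA i)).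
have sA : s <= A ^+ 2.
  apply: (@le_trans _ _ (\sum_i p i * A ^+ 2)); last by rewrite -mulr_suml p1 mul1r.
  apply: (@le_trans _ _ (\sum_i p i * Y i ^+ 2)).
    by rewrite m2 lerDl sqr_ge0.
  by apply: ler_sum => i _; rewrite ler_wpM2l.
(* From [k * eps <= 1] follows [9 * r ^+ 2 * A ^+ 4 <= s <= A ^+ 2]. This keeps [eta * Y i] within
   the range of the Taylor bound. *)
have rA : r * A <= 1 / 3.
  rewrite -(@ler_pXn2r _ 2) ?nnegrE ?mulr_ge0//.
  have A2 : 0 < A ^+ 2 by lra.
  rewrite -(ler_pM2r A2).
  have : 9 * r ^+ 2 * A ^+ 4 <= A ^+ 2.
    have : 0 <= 2 / 3 * r * E3 by rewrite !mulr_ge0//; lra.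
    have : s * (k * eps) <= s by rewrite ler_piMr// ltW.
    lra.
  have -> : (r * A) ^+ 2 * A ^+ 2 = r ^+ 2 * A ^+ 4 by ring.
  lra.
have etaY i : eta * Y i <= 3.
  apply: (@le_trans _ _ (2 * r * A)); last lra.
  apply: (@le_trans _ _ (eta * A)); last by rewrite ler_wpM2r.
  by rewrite ler_wpM2l// (le_trans (ler_norm _)).
have Y4A i : Y i ^+ 4 <= A ^+ 4.
  by rewrite (exprM _ 2 2) (exprM A 2 2) lerXn2r ?nnegrE ?sqr_ge0.
apply: (@le_trans _ _ (\sum_i (p i + eta * (p i * Y i) + eta ^+ 2 / 2 * (p i * Y i ^+ 2)
   + eta ^+ 3 / 6 * (p i * Y i ^+ 3) + eta ^+ 4 / 6 * (p i * A ^+ 4)))).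
  apply: ler_sum => i _.
  apply: (@le_trans _ _ (p i * (1 + eta * Y i + eta ^+ 2 / 2 * Y i ^+ 2
      + eta ^+ 3 / 6 * Y i ^+ 3 + eta ^+ 4 / 6 * A ^+ 4))); last first.
    by rewrite le_eqVlt; apply/orP; left; apply/eqP; ring.
  rewrite ler_wpM2l//; apply: le_trans (expR_le_taylor3 (etaY i)) _.
  have e4 : 0 <= eta ^+ 4 / 6 by rewrite divr_ge0 ?exprn_ge0.
  have := ler_wpM2l e4 (Y4A i); rewrite !exprMn; lra.
rewrite !big_split/= -!mulr_sumr -mulr_suml p1 m1 m2 muE mul1r.
have h3 : eta ^+ 3 / 6 * \sum_i p i * Y i ^+ 3 <= eta ^+ 3 / 6 * E3.
  by rewrite ler_wpM2l// divr_ge0 ?exprn_ge0.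
have c2 : eta ^+ 2 <= 4 * r ^+ 2.
  have : eta ^+ 2 <= (2 * r) ^+ 2 by rewrite lerXn2r ?nnegrE// mulr_ge0.
  rewrite exprMn; lra.
have c3 : eta ^+ 3 <= 8 * r ^+ 3.
  have : eta ^+ 3 <= (2 * r) ^+ 3 by rewrite lerXn2r ?nnegrE// mulr_ge0.
  rewrite exprMn; lra.
have etas : eta * s = 2 * r * s - 2 * r * (2 / 3 * r * E3 + 9 * r ^+ 2 * A ^+ 4).
  by rewrite -sk /eta /delta; ring.
(* The squared mean inside the second moment is of fourth order, as [s ^+ 2 <= A ^+ 4]. *)
have b1 : eta * (r ^+ 2 * s ^+ 2) <= 2 * r ^+ 3 * A ^+ 4.
  have -> : 2 * r ^+ 3 * A ^+ 4 = 2 * r * (r ^+ 2 * A ^+ 4) by ring.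
  apply: ler_pM => //; first by rewrite mulr_ge0 ?sqr_ge0.
  by rewrite ler_wpM2l ?sqr_ge0// (exprM A 2 2) lerXn2r ?nnegrE ?sqr_ge0// ltW.
have b2 := ler_wpM2r E30 c2.
have b3 := ler_wpM2r A40 c3.
have r3A : 0 <= r ^+ 3 * A ^+ 4 by rewrite mulr_ge0 ?exprn_ge0.
(* The r^3 A^4 terms add up to 1 + 8/6 - 9 < 0; those in r^2 E3 cancel. *)
have : eta * (- (r * s) + eta * (s + (r * s) ^+ 2) / 2 + eta ^+ 2 * E3 / 6
   + eta ^+ 3 * A ^+ 4 / 6) <= 0.
  apply: mulr_ge0_le0 => //; lra.
move: h3; lra.
Qed.

(** * The joint law of one arrival and one service as a finite sum *)

Lemma integral_sum_indic (R : realType) (d : measure_display)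
    (T : measurableType d) (mu : probability T R) (I : finType)
    (c : I -> R) (E : I -> set T) : (forall i, measurable (E i)) ->
  (\int[mu]_x (\sum_i c i * \1_(E i) x)%:E = (\sum_i c i * fine (mu (E i)))%:E)%E.
Proof.
move=> mE.
under eq_integral do rewrite -sumEFin.
rewrite integral_sum//; last first.
  by move=> i; under eq_fun do rewrite EFinM; exact/integrableZl/integrable_indic.
rewrite -sumEFin; apply: eq_bigr => i _.
under eq_integral do rewrite EFinM.
rewrite integralZl//; last exact: integrable_indic.
by rewrite integral_indic// setIT EFinM fineK// fin_num_measure.
Qed.

Section Joint.
Variables (R : realType) (d : measure_display) (T : measurableType d).
Variables (P : probability T R) (a s : {RV P >-> nat}) (A : R).
Hypothesis a_bnd : {ae P, forall w, (a w)%:R <= A}.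
Hypothesis s_bnd : {ae P, forall w, (s w)%:R <= A}.

Let N := (Num.truncn A).+1.

(** Almost surely both variables are integers in [[0, A]], so the square of side [N] carries all the
    mass and provides the finite index type of the reflected walk. *)
Definition joint (k : 'I_N * 'I_N) : R :=
  fine (P (a @^-1` [set (k.1 : nat)] `&` s @^-1` [set (k.2 : nat)])).

Lemma measurable_joint_event (B C : set nat) :
  measurable (a @^-1` B `&` s @^-1` C).
Proof. by apply: measurableI; exact: measurable_funPTI. Qed.

(** The pair takes countably many values, so any preimage is a countable union of joint events. *)
Lemma measurable_joint d' (T' : measurableType d') (h : nat -> nat -> T') :
  measurable_fun setT (fun w => h (a w) (s w)).
Proof.
move=> _ B mB; rewrite setTI.
have -> : (fun w => h (a w) (s w)) @^-1` B =
    \bigcup_i \bigcup_j ((a @^-1` [set i] `&` s @^-1` [set j]) `&`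
      [set _ | B (h i j)]).
  apply/seteqP; split=> w /=; first by exists (a w) => //; exists (s w).
  by move=> [i _ [j _ /= [[-> ->]]]].
apply: bigcup_measurable => i _; apply: bigcup_measurable => j _.
apply: measurableI; first exact: measurable_joint_event.
have [Bh|nBh] := pselect (B (h i j)).
  by rewrite (_ : [set _ | _] = setT)//; apply/seteqP; split.
by rewrite (_ : [set _ | _] = set0)//; apply/seteqP; split.
Qed.

Lemma expectation_joint (h : nat -> nat -> R) :
  ('E_P[fun w => h (a w) (s w)] = (\sum_k joint k * h k.1 k.2)%:E)%E.
Proof.
rewrite unlock.
rewrite (ae_eq_integral (fun w => (\sum_k h (k : 'I_N * 'I_N).1 k.2 *
   \1_(a @^-1` [set (k.1 : nat)] `&` s @^-1` [set (k.2 : nat)]) w)%:E)) //=.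
- rewrite integral_sum_indic; last by move=> k; exact: measurable_joint_event.
  by congr EFin; apply: eq_bigr => k _; rewrite mulrC.
- exact/measurable_EFinP/measurable_joint.
- apply/measurable_EFinP; apply: measurable_sum => k.
  by apply: measurable_funM => //; exact/measurable_indic/measurable_joint_event.
- apply: filterS2 a_bnd s_bnd => w aA sA _; congr EFin.
  have A0 : 0 <= A by apply: le_trans aA.
  have aN : (a w < N)%N by rewrite ltnS truncn_ge_nat.
  have sN : (s w < N)%N by rewrite ltnS truncn_ge_nat.
  rewrite (bigD1 (Ordinal aN, Ordinal sN))//= big1 ?addr0; last first.
    move=> [i j] ij; rewrite indicE memNset ?mulr0//= => -[ai sj].
    by move/eqP: ij; apply; congr pair; exact: val_inj.
  by rewrite indicE mem_set ?mulr1.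
Qed.

Lemma joint_ge0 k : 0 <= joint k.
Proof. exact: fine_ge0. Qed.

Lemma joint_sum1 : \sum_k joint k = 1.
Proof.
have := expectation_joint (fun _ _ => 1).
rewrite (expectation_cst P 1) => -[->].
by apply: eq_bigr => k _; rewrite mulr1.
Qed.

Lemma bound_ge0 : 0 <= A.
Proof.
have PT : (0 < P setT)%E by rewrite probability_setT.
have PF : ProperFilter (almost_everywhere P) by exact: ae_properfilter_algebraOfSetsType.
by have [w] := filter_ex a_bnd; apply: le_trans.
Qed.

Lemma support_le (i : 'I_N) : i%:R <= A.
Proof. by rewrite -truncn_ge_nat ?bound_ge0// -ltnS. Qed.

Lemma joint_diff_le (k : 'I_N * 'I_N) :
  `|(k.1 : nat)%:R - (k.2 : nat)%:R| <= A.
Proof.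
have := support_le k.1; have := support_le k.2.
have := ler0n R k.1; have := ler0n R k.2; rewrite ler_norml; lra.
Qed.

(** Siegmund duality: for [n > 0], one queue step from [m] reaches level [n] exactly when [m] is at
    least [n + k.2 - k.1], so stationarity tested on half-lines is harmonicity of the tail. *)
Lemma joint_stationary (nu : probability nat R) : queue_stationary P a s nu ->
  forall n, (0 < n)%N -> fine (nu [set k | (n <= k)%N]) =
    \sum_k joint k * fine (nu [set m | (n + k.2 - k.1 <= m)%N]).
Proof.
move=> st n n0; rewrite (st _ I).
rewrite -[RHS]/(fine (_%:E)); congr fine.
rewrite -integral_sum_indic; last by [].
apply: eq_integral => m _.
rewrite -expectation_indic; last first.
  have := @measurable_joint _ _ (fun i j => queue_step m i j : nat) measurableT.
  by move=> /(_ [set k | (n <= k)%N] I); rewrite setTI.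
rewrite (_ : \1_ _ = fun w => \1_[set k | (n <= k)%N] (queue_step m (a w) (s w)) : R)//.
rewrite (expectation_joint (fun i j => \1_[set k | (n <= k)%N] (queue_step m i j))).
congr EFin; apply: eq_bigr => k _; congr (_ * _); rewrite !indicE; congr ((nat_of_bool _)%:R).
apply/idP/idP; rewrite !inE/= /queue_step; lia.
Qed.

End Joint.

Arguments joint {R d T P} a s A k.

(** * Independence of the pair, vanishing tails, and a variance bound *)

Lemma independent_pair (R : realType) (d : measure_display) (T : measurableType d)
    (P : probability T R) (q0 : {RV P >-> nat}) (a s : nat -> {RV P >-> nat}) :
  mutually_independent P (queue_inputs P q0 a s) -> forall B C : set nat,
  P (a 0%N @^-1` B `&` s 0%N @^-1` C) = (P (a 0%N @^-1` B) * P (s 0%N @^-1` C))%E.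
Proof.
move=> ind B C.
have := ind [fset Some (inl 0%N); Some (inr 0%N)]%fset
  (fun i => if i is Some (inl _) then B else C) (fun _ _ => I).
rewrite big_fsetU1 ?inE//= big_seq_fset1 => <-; congr (P _).
apply/seteqP; split => w /=.
  by move=> [Bw Cw] i /=; rewrite !inE => /orP[]/eqP ->.
by move=> H; split; [apply: (H (Some (inl 0%N)))|apply: (H (Some (inr 0%N)))];
  rewrite /= !inE eqxx ?orbT.
Qed.

Lemma tail_cvg0 (R : realType) (nu : probability nat R) (e : R) : 0 < e ->
  exists N, forall n, (N <= n)%N -> fine (nu [set k | (n <= k)%N]) <= e.
Proof.
move=> e0.
have : (fun n => nu [set k | (n <= k)%N]) @ \oo --> 0%:E.
  have -> : 0%:E = nu (\bigcap_n [set k | (n <= k)%N]).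
    rewrite (_ : \bigcap_n _ = set0) ?measure0//.
    by apply/seteqP; split => // k /(_ k.+1 I) /=; rewrite ltnn.
  apply: nonincreasing_cvg_mu => //.
    by rewrite ltey_eq fin_num_measure.
  move=> m n mn; apply/subsetPset => k /=; exact: leq_trans.
move=> /fine_cvg/cvgrPdist_le /(_ e e0) [M _ HM]; exists M => n /HM /=.
by rewrite sub0r normrN; apply: le_trans; exact: ler_norm.
Qed.

(** This is the average of [f * (A - f) >= 0]. It makes a variable of mean 0 degenerate, which later
    excludes [mu = 0]. *)
Lemma bhatia_davis (R : realType) (I : finType) (p : I -> R)
    (p0 : forall i, 0 <= p i) (p1 : \sum_i p i = 1) (A : R) (f : I -> R) :
  (forall i, 0 <= f i <= A) ->
  \sum_i p i * (f i - \sum_j p j * f j) ^+ 2 <=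
    (\sum_i p i * f i) * (A - \sum_i p i * f i).
Proof.
move=> fA; set m := \sum_i p i * f i.
have -> : m * (A - m) = \sum_i ((A - 2 * m) * (p i * f i) + m ^+ 2 * p i).
  by rewrite big_split/= -!mulr_sumr -/m p1; ring.
apply: ler_sum => i _; have /andP[f0 f1] := fA i.
have := mulr_ge0 (p0 i) (mulr_ge0 f0 (_ : 0 <= A - f i)).
rewrite subr_ge0 => /(_ f1); lra.
Qed.

(** * Moments of the increment under the joint law *)

Section Moments.
Variables (R : realType) (d : measure_display) (T : measurableType d).
Variables (P : probability T R) (a s : {RV P >-> nat}) (A : R).
Hypothesis a_bnd : {ae P, forall w, (a w)%:R <= A}.
Hypothesis s_bnd : {ae P, forall w, (s w)%:R <= A}.
Variables (lambda mu va vs : R).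
Hypothesis a_mean : 'E_P[fun w => (a w)%:R%R]%E = lambda%:E.
Hypothesis s_mean : 'E_P[fun w => (s w)%:R%R]%E = mu%:E.
Hypothesis a_var : 'V_P[fun w => (a w)%:R%R]%E = va%:E.
Hypothesis s_var : 'V_P[fun w => (s w)%:R%R]%E = vs%:E.

Let p := joint a s A.

Lemma joint_mean_a : \sum_k p k * (k.1 : nat)%:R = lambda.
Proof.
by have := expectation_joint a_bnd s_bnd (fun i _ => i%:R);
  rewrite /= a_mean => -[].
Qed.

Lemma joint_mean_s : \sum_k p k * (k.2 : nat)%:R = mu.
Proof.
by have := expectation_joint a_bnd s_bnd (fun _ j => j%:R);
  rewrite /= s_mean => -[].
Qed.

Lemma joint_var_a : \sum_k p k * ((k.1 : nat)%:R - lambda) ^+ 2 = va.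
Proof.
have := expectation_joint a_bnd s_bnd (fun i _ => (i%:R - lambda) ^+ 2).
move: a_var; rewrite /variance unlock a_mean /=.
have -> : ((fun w => (a w)%:R) \- cst lambda) * ((fun w => (a w)%:R) \- cst lambda)
  = (fun w => ((a w)%:R - lambda) ^+ 2) by [].
by move=> -> [].
Qed.

Lemma joint_var_s : \sum_k p k * ((k.2 : nat)%:R - mu) ^+ 2 = vs.
Proof.
have := expectation_joint a_bnd s_bnd (fun _ j => (j%:R - mu) ^+ 2).
move: s_var; rewrite /variance unlock s_mean /=.
have -> : ((fun w => (s w)%:R) \- cst mu) * ((fun w => (s w)%:R) \- cst mu)
  = (fun w => ((s w)%:R - mu) ^+ 2) by [].
by move=> -> [].
Qed.

Lemma joint_mean_diff : \sum_k p k * ((k.1 : nat)%:R - (k.2 : nat)%:R) = lambda - mu.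
Proof.
under eq_bigr do rewrite mulrBr.
by rewrite sumrB joint_mean_a joint_mean_s.
Qed.

Lemma joint_third_moment :
  \sum_k p k * ((k.1 : nat)%:R - (k.2 : nat)%:R) ^+ 3 <= third_moment_pos P a s.
Proof.
rewrite /third_moment_pos.
rewrite (expectation_joint a_bnd s_bnd (fun i j => (i%:R - j%:R) ^+ 3)).
by rewrite /= le_max lexx orbT.
Qed.

Lemma joint_var_le : va + vs <= lambda * (A - lambda) + mu * (A - mu).
Proof.
have p0 : forall k, 0 <= p k := @joint_ge0 _ _ _ _ _ _ _.
have p1 := joint_sum1 a_bnd s_bnd.
have leA := support_le a_bnd.
have := @bhatia_davis _ _ p p0 p1 A (fun k => (k.1 : nat)%:R).
have := @bhatia_davis _ _ p p0 p1 A (fun k => (k.2 : nat)%:R).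
rewrite joint_mean_a joint_mean_s joint_var_a joint_var_s => hs ha.
by apply: lerD; [apply: ha|apply: hs] => k; rewrite ler0n leA.
Qed.

Hypothesis indep : forall B C : set nat,
  P (a @^-1` B `&` s @^-1` C) = (P (a @^-1` B) * P (s @^-1` C))%E.

(** Independence factorises [joint], so the sum is a product of one-dimensional sums, one of them a
    centred first moment. *)
Lemma joint_cov0 :
  \sum_k p k * (((k.1 : nat)%:R - lambda) * ((k.2 : nat)%:R - mu)) = 0.
Proof.
pose pa i := fine (P (a @^-1` [set i])); pose ps i := fine (P (s @^-1` [set i])).
have pE k : p k = pa k.1 * ps k.2.
  by rewrite /p /joint indep fineM// fin_num_measure//; exact: measurable_funPTI.
have split f g : \sum_k p k * (f (k.1 : nat) * g (k.2 : nat)) =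
    (\sum_(i < (Num.truncn A).+1) pa i * f i) *
    (\sum_(j < (Num.truncn A).+1) ps j * g j).
  rewrite big_distrlr/= pair_bigA/=.
  by apply: eq_bigr => k _; rewrite pE mulrACA.
(* [pa] and [ps] need not be shown to sum to 1: the product of the sums is 1. *)
have := split (fun i => i%:R - lambda) (fun _ => 1).
under eq_bigr do rewrite mulr1 mulrBr.
rewrite sumrB joint_mean_a -mulr_suml joint_sum1// mul1r subrr => /esym/eqP.
rewrite mulf_eq0 => /orP[/eqP a0|/eqP s0].
  by rewrite (split (fun i => i%:R - lambda) (fun j => j%:R - mu)) a0 mul0r.
have := split (fun _ => 1) (fun _ => 1).
rewrite s0 mulr0; under eq_bigr do rewrite !mulr1.
by rewrite joint_sum1// => /eqP; rewrite oner_eq0.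
Qed.

Lemma joint_second_moment :
  \sum_k p k * ((k.1 : nat)%:R - (k.2 : nat)%:R) ^+ 2 =
  va + vs + (lambda - mu) ^+ 2.
Proof.
(* Expansion of the square around the two means, with the linear term rewritten through the
   increment itself. *)
rewrite (eq_bigr (fun k => p k * ((k.1 : nat)%:R - lambda) ^+ 2
  + p k * ((k.2 : nat)%:R - mu) ^+ 2
  - 2 * (p k * (((k.1 : nat)%:R - lambda) * ((k.2 : nat)%:R - mu)))
  + 2 * (lambda - mu) * (p k * ((k.1 : nat)%:R - (k.2 : nat)%:R))
  - (lambda - mu) ^+ 2 * p k)); last by move=> k _; ring.
rewrite sumrB big_split/= sumrB big_split/= -!mulr_sumr.
rewrite joint_var_a joint_var_s joint_cov0 joint_mean_diff joint_sum1//; ring.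
Qed.

End Moments.

(** * Existence of the logarithmic decay rate *)

Section LogTail.
Variables (R : realType) (u : nat -> R).
Hypothesis u0 : u 0%N = 1.
Hypothesis u_nincr : forall m n, (m <= n)%N -> u n <= u m.
Hypothesis u_mul : forall m n, u m * u n <= u (m + n)%N.

Lemma is_cvg_log_tail (eps : R) : 0 < eps ->
  cvg ((x^-1%:E * lne (u (Num.truncn (x / eps)).+1)%:E)%E @[x --> +oo%R]).
Proof.
(* If [u 1 <= 0] the logarithm is [-oo] for all large [x] and so is the limit; otherwise
   supermultiplicativity keeps every [u n] positive. *)
move=> eps0; have [u1|u1] := leP (u 1%N) 0.
  apply/cvg_ex; exists -oo%E; apply: cvg_near_cst.
  near=> x; have x0 : 0 < x by near: x; exact: nbhs_pinfty_gt.
  rewrite le0_lneNy ?lee_fin ?(le_trans _ u1) ?u_nincr//.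
  by rewrite gt0_muleNy// lte_fin invr_gt0.
have u_gt0 n : 0 < u n.
  elim: n => [|n ih]; first by rewrite u0.
  by rewrite -addn1; apply: lt_le_trans (u_mul _ _); rewrite mulr_gt0.
have u_le1 n : u n <= 1 by rewrite -u0 u_nincr.
pose w x := - ln (u (Num.truncn (x / eps)).+1).
have /cvg_ex[l wl] : cvg (x^-1 * w x @[x --> +oo%R]).
  apply: is_cvg_div_subadditive => [x x0|x y x0 xy|x y x0 y0].
  - by rewrite oppr_ge0 -ln1 ler_ln ?posrE.
  - rewrite lerN2 ler_ln ?posrE// u_nincr// ltnS le_truncn//.
    by rewrite ler_wpM2r// invr_ge0 ltW.
  - rewrite -opprD lerN2 -lnM ?posrE// ler_ln ?posrE ?mulr_gt0//.
    (* The two successors on the smaller side absorb the carry when integer parts are added. *)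
    apply: le_trans (u_mul _ _) _; apply: u_nincr; rewrite addSn ltnS.
    have xe : 0 <= x / eps by rewrite divr_ge0// ltW.
    have ye : 0 <= y / eps by rewrite divr_ge0// ltW.
    rewrite -ltnS -addSn truncn_lt_nat mulrDl ?addr_ge0// natrD.
    have /andP[_ h1] := truncn_itv xe; have /andP[_ h2] := truncn_itv ye.
    exact: ltrD.
apply/cvg_ex; exists (- l)%:E.
have : (EFin (- (x^-1 * w x)) @[x --> +oo%R]) --> (- l)%:E.
  by apply: cvg_EFin; [exact: nearW|exact: cvgN].
apply: cvg_trans; apply: near_eq_cvg; apply: nearW => x.
by rewrite lne_EFin// -EFinM /w mulrN opprK.
Unshelve. all: by end_near. Qed.

End LogTail.

(** * Tail bound and decay rate of the stationary queue *)

Unset Implicit Arguments.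

Theorem theorem5 (R : realType)
    (* the queue *)
    (d : measure_display) (T : measurableType d) (P : probability T R)
    (a s Q : nat -> {RV P >-> nat})
    (eps lambda mu sigma_a sigma_s A : R)
    (heps : 0 < eps < 1)
    (hlambda : lambda = mu * (1 - eps))
    (hindep : mutually_independent P (queue_inputs P (Q 0%N) a s))
    (ha_id : identically_distributed P a)
    (hs_id : identically_distributed P s)
    (ha_mean : forall t : nat, 'E_P[fun w => (a t w)%:R%R]%E = lambda%:E)
    (hs_mean : forall t : nat, 'E_P[fun w => (s t w)%:R%R]%E = mu%:E)
    (ha_var : forall t : nat, 'V_P[fun w => (a t w)%:R%R]%E = (sigma_a ^+ 2)%:E)
    (hs_var : forall t : nat, 'V_P[fun w => (s t w)%:R%R]%E = (sigma_s ^+ 2)%:E)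
    (ha_bnd : forall t : nat, {ae P, forall w, (a t w)%:R <= A})
    (hs_bnd : forall t : nat, {ae P, forall w, (s t w)%:R <= A})
    (hQ : forall (t : nat) (w : T),
        Q t.+1 w = queue_step (Q t w) (a t w) (s t w))
    (* the steady-state queue length, on a probability space of its own *)
    (d' : measure_display) (T' : measurableType d') (P' : probability T' R)
    (q : {RV P' >-> nat})
    (hq : queue_stationary P (a 0%N) (s 0%N) (distribution P' q)) :
  let sigma2 := sigma_a ^+ 2 + sigma_s ^+ 2 in
  let theta_eps := theta_of mu sigma2 in
  let E3 := third_moment_pos P (a 0%N) (s 0%N) in
  let kappa1 := kappa1_of eps mu sigma2 A E3 in
  let tail := fun x : R => P' [set w | x < eps * (q w)%:R] in
  0 < sigma2 ->
  (forall theta : R, theta <= theta_eps ->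
     ('E_P[fun w => expR (eps * theta * (Q 0%N w)%:R)%R] < +oo)%E) ->
  (forall x : R, (1 + kappa1 * eps) / theta_eps < x ->
     (tail x <= (expR 1 * theta_eps * x *
                 expR (- (theta_eps * (1 - kappa1 * eps) * x)))%:E)%E) /\
  cvg ((x^-1%:E * lne (tail x))%E @[x --> +oo%R]) /\
  (lim ((x^-1%:E * lne (tail x))%E @[x --> +oo%R]) <=
     (- (theta_eps * (1 - kappa1 * eps)))%:E)%E.
Proof.
move=> sigma2 theta_eps E3 kappa1 tail sigma20 _.
have /andP[eps0 eps1] := heps.
have aA := ha_bnd 0%N; have sA := hs_bnd 0%N.
pose p := joint (a 0%N) (s 0%N) A.
have p0 : forall k, 0 <= p k := @joint_ge0 _ _ _ _ _ _ _.
have p1 : \sum_k p k = 1 := joint_sum1 aA sA.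
have A0 : 0 <= A := bound_ge0 aA.
have mean := joint_mean_diff aA sA (ha_mean 0%N) (hs_mean 0%N).
have var_le := joint_var_le aA sA (ha_mean 0%N) (hs_mean 0%N)
  (ha_var 0%N) (hs_var 0%N).
have second := joint_second_moment aA sA (ha_mean 0%N)
  (hs_mean 0%N) (ha_var 0%N) (hs_var 0%N) (independent_pair hindep).
have third := joint_third_moment aA sA.
rewrite -/p -/E3 -/sigma2 in mean var_le second third.
clearbody sigma2.
have drift : lambda - mu = - (mu * eps) by rewrite hlambda; ring.
rewrite drift sqrrN in mean second.
have mu0 : 0 < mu.
  have mu_ge0 : 0 <= mu.
    rewrite -(joint_mean_s aA sA (hs_mean 0%N)).
    by apply: sumr_ge0 => k _; rewrite mulr_ge0// p0.
  (* With [mu = 0] also [lambda = 0], and the variance bound contradicts [0 < sigma2]. *)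
  rewrite lt_neqAle mu_ge0 andbT; apply/eqP => mu0.
  by move: var_le; rewrite hlambda -mu0 !mul0r addr0 leNgt sigma20.
(* Otherwise the mean increment, which is [- (mu * eps) < 0], would be a sum of nonnegative
   terms. *)
have down : exists k, 0 < p k /\ (k.1 < k.2)%N.
  apply: contrapT => nodown.
  have : 0 <= - (mu * eps).
    rewrite -mean; apply: sumr_ge0 => k _.
    have [k12|k21] := ltnP k.1 k.2; last by rewrite mulr_ge0 ?p0// subr_ge0 ler_nat.
    have : ~~ (0 < p k) by apply/negP => pk; apply: nodown; exists k.
    by rewrite -leNgt => pk; rewrite (_ : p k = 0) ?mul0r//; apply/eqP; rewrite eq_le pk p0.
  by rewrite oppr_ge0 leNgt mulr_gt0.
pose nu : probability nat R := distribution P' q.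
pose u n : R := fine (nu [set k | (n <= k)%N]).
have nuE n : nu [set k | (n <= k)%N] = (u n)%:E by rewrite fineK// fin_num_measure.
have u_ge0 n : 0 <= u n by exact: fine_ge0.
have u0 : u 0%N = 1.
  by rewrite /u (_ : [set k | _] = setT) ?probability_setT//; apply/seteqP; split.
have u_nincr m n : (m <= n)%N -> u n <= u m.
  move=> mn; rewrite -lee_fin -!nuE; apply: le_measure; rewrite ?inE//.
  by move=> k /=; exact: leq_trans.
have u_harm n : (0 < n)%N -> u n = \sum_k p k * u (n + k.2 - k.1)%N.
  exact: (joint_stationary aA sA hq).
have u_cvg0 (e : R) := @tail_cvg0 R nu e.
have u_mul := tail_supermultiplicative p0 p1 down u_ge0 u0 u_nincr u_cvg0 u_harm.
(* The strict inequality [x < eps * q] means that the integer [q] is at least the integer part of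
   [x / eps] plus one. *)
have tailE (x : R) : 0 <= x -> tail x = (u (Num.truncn (x / eps)).+1)%:E.
  move=> x0; rewrite -nuE; congr (P' _); apply/funext => w; apply/propext => /=.
  have xe0 : 0 <= x / eps by rewrite divr_ge0// ltW.
  by rewrite truncn_lt_nat// ltr_pdivrMr// mulrC.
have theta0 : 0 < theta_eps by rewrite /theta_eps /theta_of divr_gt0// mulr_gt0.
have E30 : 0 <= E3 by rewrite /E3 /third_moment_pos le_max lexx.
have kappa0 : 0 <= kappa1.
  have [e' m' s'] := And3 (ltW eps0) (ltW mu0) (ltW sigma20).
  by rewrite /kappa1 /kappa1_of addr_ge0// ?mulr_ge0 ?invr_ge0 ?mulr_ge0 ?exprn_ge0.
(* This pure exponential bound yields both conclusions. *)
have tail_le (x : R) : 0 <= x ->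
    (tail x <= (expR (- (theta_eps * (1 - kappa1 * eps) * x)))%:E)%E.
  move=> x0; rewrite tailE// lee_fin.
  have [k1|k1] := leP (kappa1 * eps) 1; last first.
    apply: (@le_trans _ _ 1); first by rewrite -u0 u_nincr.
    rewrite -[leLHS]expR0 ler_expR oppr_ge0 mulr_le0_ge0//.
    by apply: mulr_ge0_le0; [exact: ltW|rewrite subr_le0 ltW].
  pose eta := eps * (theta_eps * (1 - kappa1 * eps)).
  have delta0 : 0 <= theta_eps * (1 - kappa1 * eps).
    by apply: mulr_ge0; [exact: ltW|rewrite subr_ge0].
  have eta0 : 0 <= eta by apply: mulr_ge0 => //; exact: ltW.
  have mgf : \sum_k p k * expR (eta * ((k.1 : nat)%:R - (k.2 : nat)%:R)) <= 1.
    apply: (@mgf_le1 R _ p (fun k => (k.1 : nat)%:R - (k.2 : nat)%:R) eps mu sigma2 A E3)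
      => //; last exact: ltW.
    exact: (joint_diff_le aA).
  apply: le_trans (lundberg p0 p1 down u0 u_cvg0 u_harm eta0 mgf _) _.
  have nx : x <= eps * (Num.truncn (x / eps)).+1%:R.
    rewrite mulrC -ler_pdivrMr//; apply: ltW.
    by have /andP[] := truncn_itv (divr_ge0 x0 (ltW eps0)).
  by rewrite ler_expR lerN2 (le_trans (ler_wpM2l delta0 nx))// mulrCA mulrA.
have tail_near : \forall x \near +oo%R,
    (x^-1%:E * lne (tail x))%E = (x^-1%:E * lne (u (Num.truncn (x / eps)).+1)%:E)%E.
  by near=> x; rewrite tailE//; near: x; apply: nbhs_pinfty_ge; exact: num_real.
have tail_cvg : cvg ((x^-1%:E * lne (tail x))%E @[x --> +oo%R]).
  have /cvg_ex[l ul] := is_cvg_log_tail u0 u_nincr u_mul eps0.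
  apply/cvg_ex; exists l; apply: cvg_trans ul; apply: near_eq_cvg.
  by apply: filterS tail_near => x ->.
split; last split=> //.
  (* The range of [x] forces [theta_eps * x >= 1], so the prefactor is at least 1. *)
  move=> x; rewrite ltr_pdivrMr// => xgt.
  have x1 : 1 <= theta_eps * x.
    by rewrite mulrC; apply: le_trans (ltW xgt); rewrite lerDl mulr_ge0// ltW.
  have x0 : 0 <= x by rewrite -(pmulr_rge0 _ theta0); lra.
  apply: le_trans (tail_le _ x0) _; rewrite lee_fin ler_peMl ?expR_ge0//.
  rewrite -mulrA; have := expR_ge1Dx (1 : R); nra.
apply: lime_le => //; near=> x.
have x0 : 0 < x by near: x; exact: nbhs_pinfty_gt.
(* After multiplication by [x] the claim is the logarithm of [tail_le]; a zero tail is covered by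
   [lne] being [-oo] there. *)
rewrite -(@lee_pmul2l _ x%:E)// muleA -EFinM divff ?gt_eqF// mul1e.
rewrite -EFinM -[leRHS]expeRK lee_lne ?in_itv/= ?measure_ge0 ?leey ?lee_fin ?expR_ge0//.
by rewrite mulrC mulNr; apply: tail_le; exact: ltW.
Unshelve. all: by end_near. Qed.
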